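(* Let $\mathcal{H}$ be a finite-dimensional complex Hilbert space with $\dim \mathcal{H} \ge 2$. There is no operator $D$ acting on $\mathcal{H} \otimes \mathcal{H}$ such that for all (arbitrary) unit vectors (states) $\ket{\psi}, \ket{\phi} \in \mathcal{H}$, \[ D\,\ket{\psi}\ket{\phi} \;=\; \ket{\psi} \otimes \left( \mathbb{I} - 2\ket{\psi}\bra{\psi} \right)\ket{\phi}. \]
   Context: Here $\mathbb{I}$ is the identity on $\mathcal{H}$, $\ket{\psi}\bra{\psi}$ is the orthogonal projection onto the line spanned by $\ket{\psi}$, and $\ket{\psi}\ket{\phi}$ denotes $\ket{\psi}\otimes\ket{\phi}$. An operator $D$ with this property would be called a ''general diffusion'' gate; the claim is that no such quantum operation exists. *)

(* Defs.v *)
From HB Require Import structures.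
From mathcomp Require Import all_boot all_order all_algebra.
From mathcomp Require Export sesquilinear complex reals.

Set Implicit Arguments.
Unset Strict Implicit.
Unset Printing Implicit Defensive.

Import GRing.Theory Num.Theory Num.Def.
Local Open Scope ring_scope.

(* A finite-dimensional complex Hilbert space is a vectType over R[i],
   R : realType, with a positive definite Hermitian form
   dotp : {dot H for conjC}; completeness is automatic in finite dimension.
   Such forms are linear in the FIRST argument and conjugate-linear in the
   second, so Dirac's <u|v> is dotp v u. *)

Definition unit_vector (C : numClosedFieldType) (H : vectType C)
    (dotp : {dot H for conjC}) (psi : H) : Prop :=
  sqrtC (dotp psi psi) = 1.

(* The operator |u><v|, that is x |-> <v|x> u. *)
Definition ketbra (C : numClosedFieldType) (H : vectType C)
    (dotp : {dot H for conjC}) (u v : H) : 'End(H) :=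
  linfun (fun x : H => dotp x v *: u).

(* T together with t is a tensor product of U and V: every bilinear map out of
   U x V factors uniquely through t via a linear map. *)
Definition is_tensor_product (K : fieldType) (U V T : lmodType K)
    (t : {bilinear U -> V -> T}) : Prop :=
  forall (W : lmodType K) (b : {bilinear U -> V -> W}),
    (exists f : {linear T -> W}, forall u v, f (t u v) = b u v) /\
    (forall f g : {linear T -> W},
       (forall u v, f (t u v) = b u v) -> (forall u v, g (t u v) = b u v) ->
       f =1 g).

(* linfun f agrees with f only when f is linear, as it is here. *)
Lemma ketbraE (C : numClosedFieldType) (H : vectType C)
    (dotp : {dot H for conjC}) (u v x : H) :
  ketbra dotp u v x = dotp x v *: u.
Proof.
pose f := fun y : H => dotp y v *: u.
have fL : linear f by move=> a y z; rewrite /f linearPl scalerDl scalerA.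
pose fM := GRing.isLinear.Build _ _ _ _ f fL.
pose fLin : {linear H -> H} := HB.pack f fM.
exact: (lfunE fLin).
Qed.

Lemma tensor_product_exists (K : fieldType) (U V : vectType K) :
  exists (T : vectType K) (t : {bilinear U -> V -> T}), is_tensor_product t.
Proof.
pose T : vectType K := 'M[K]_(\dim {:U}, \dim {:V}).
pose X := vbasis {:U}; pose Y := vbasis {:V}.
pose t (u : U) (v : V) : T := \matrix_(i, j) (coord X i u * coord Y j v).
have tB : bilinear_for *:%R *:%R t.
  split=> [v|u] a x y; apply/matrixP => i j; rewrite !mxE linearP /=.
    by rewrite mulrDl mulrA.
  by rewrite mulrDr mulrCA.
pose tM := bilinear_isBilinear.Build _ _ _ _ _ _ t tB.
pose tt : {bilinear U -> V -> T} := HB.pack t tM.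
exists T, tt => W b.
have XE (u : U) : u = \sum_i coord X i u *: X`_i.
  exact: coord_vbasis (memvf u).
have YE (v : V) : v = \sum_i coord Y i v *: Y`_i.
  exact: coord_vbasis (memvf v).
have bE u v : b u v = \sum_i \sum_j (coord X i u * coord Y j v) *: b X`_i Y`_j.
  rewrite {1}(XE u) linear_sumlz; apply: eq_bigr => i _.
  rewrite linearZl_LR {1}(YE v) linear_sumr scaler_sumr; apply: eq_bigr => j _.
  by rewrite linearZr_LR scalerA.
split.
  pose f (M : T) : W := \sum_i \sum_j M i j *: b X`_i Y`_j.
  have fL : linear f.
    move=> a M N; rewrite /f scaler_sumr -big_split; apply: eq_bigr => i _.
    rewrite scaler_sumr -big_split; apply: eq_bigr => j _.
    by rewrite !mxE scalerDl scalerA.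
  pose fM := GRing.isLinear.Build _ _ _ _ f fL.
  pose ff : {linear T -> W} := HB.pack f fM.
  exists ff => u v; rewrite bE; apply: eq_bigr => i _; apply: eq_bigr => j _.
  by rewrite mxE.
move=> f g fE gE M; rewrite (matrix_sum_delta M) !linear_sum.
apply: eq_bigr => i _; rewrite !linear_sum; apply: eq_bigr => j _.
rewrite !linearZ; congr (_ *: _).
have -> : delta_mx i j = tt X`_i Y`_j; last by rewrite fE gE.
apply/matrixP => k l; rewrite !mxE.
rewrite !coord_free ?(basis_free (vbasisP _)) // -natrM mulnb.
by rewrite -!val_eqE /= (eq_sym (val k)) (eq_sym (val l)).
Qed.

(* Main.v *)
Require Import Defs.
From HB Require Import structures.
From mathcomp Require Import all_boot all_order all_algebra.
From mathcomp Require Import sesquilinear complex reals.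
From mathcomp Require Import ring.

Set Implicit Arguments.
Unset Strict Implicit.
Unset Printing Implicit Defensive.

Import GRing.Theory Num.Theory Num.Def.
Local Open Scope ring_scope.

(* For orthonormal e0, e1 put psi = (3 e0 + 4 e1) / 5.  Linearity gives
   D (psi (x) e0) = (- 3 e0 (x) e0 + 4 e1 (x) e0) / 5, which has no component
   along e1 (x) e1, whereas psi (x) (1 - 2 |psi><psi|) e0 has component
   - 96 / 125 there. *)

(** One Gram-Schmidt step: the dimension bound gives [x] outside the zero space and [y] outside the
    line of [x]; removing from [y] its projection on [x] leaves a nonzero [z] orthogonal to [x]. *)
Lemma exists_orthonormal_pair (C : numClosedFieldType) (H : vectType C)
    (dotp : {dot H for conjC}) :
  (2 <= \dim {:H})%N -> exists e0 e1 : H, orthonormal dotp [:: e0; e1].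
Proof.
move=> dimH.
have normalize (u : H) : u != 0 ->
    dotp ((sqrtC (dotp u u))^-1 *: u) ((sqrtC (dotp u u))^-1 *: u) = 1.
  move=> u0; rewrite dnormZ normfV exprVn ger0_norm ?sqrt_dnorm_ge0 //.
  by rewrite sqrtCK mulVf ?dnorm_eq0.
have /subvPn[x _ xN0] : ~~ ({:H} <= 0)%VS.
  by apply: contraL dimH => /dimvS; rewrite dimv0 -ltnNge => /leq_ltn_trans->.
have x0 : x != 0 by rewrite -memv0.
have /subvPn[y _ yNx] : ~~ ({:H} <= <[x]>)%VS.
  apply: contraL dimH => /dimvS; rewrite dim_vline x0 -ltnNge.
  by move=> /leq_ltn_trans->.
pose z := y - (dotp y x / dotp x x) *: x.
have z0 : z != 0.
  by apply: contraNneq yNx => /subr0_eq->; rewrite memvZ // memv_line.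
have zx : dotp z x = 0.
  by rewrite linearBl linearZl_LR /= divfK ?dnorm_eq0 // subrr.
exists ((sqrtC (dotp z z))^-1 *: z), ((sqrtC (dotp x x))^-1 *: x).
apply/orthonormal2P; split; rewrite ?normalize //.
by rewrite linearZl_LR linearZr_LR /= zx !mulr0.
Qed.

(** The product of two functionals is bilinear, so the universal property factors it through [t].
    This reads off one coordinate of a tensor without choosing a basis of [T]. *)
Lemma exists_tensor_functional (K : fieldType) (U V T : lmodType K)
    (t : {bilinear U -> V -> T}) (f : {linear U -> K^o}) (g : {linear V -> K^o}) :
  is_tensor_product t ->
  exists h : {linear T -> K^o}, forall u v, h (t u v) = f u * g v.
Proof.
pose b (u : U) (v : V) : K^o := f u * g v.
have bB : bilinear_for *:%R *:%R b.
  split=> [v|u] a x y; rewrite /b linearP /=.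
    by rewrite mulrDl -scalerAl.
  by rewrite mulrDr -scalerAr.
pose bM := bilinear_isBilinear.Build _ _ _ _ _ _ b bB.
pose bb : {bilinear U -> V -> K^o} := HB.pack b bM.
by move=> /(_ _ bb)[].
Qed.

Lemma no_general_diffusion (C : numClosedFieldType) (H : vectType C)
    (dotp : {dot H for conjC})
    (HH : vectType C) (tensor : {bilinear H -> H -> HH})
    (tensorP : is_tensor_product tensor)
    (dimH : (2 <= \dim {:H})%N) :
  ~ exists D : 'End(HH),
      forall psi phi : H, unit_vector dotp psi -> unit_vector dotp phi ->
        D (tensor psi phi) =
        tensor psi ((\1 - 2%:R *: ketbra dotp psi psi)%VF phi).
Proof.
move=> [D DE].
have [e0 [e1 /orthonormal2P[e01 e00 e11]]] := exists_orthonormal_pair dotp dimH.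
have e10 : dotp e1 e0 = 0 by rewrite hermC /= e01 conjC0 mulr0.
have unitP u : dotp u u = 1 -> unit_vector dotp u.
  by rewrite /unit_vector => ->; rewrite sqrtC1.
(* The triple 3, 4, 5 gives a unit vector with nonzero rational coefficients; [ring] treats [c] as
   an atom and [c5] finishes. *)
pose c : C := 5^-1; have c5 : c * 5 = 1 by rewrite mulVf ?pnatr_eq0.
pose psi : H := (c * 3) *: e0 + (c * 4) *: e1.
have cr : c^* = c by rewrite geC0_conj // invr_ge0 ler0n.
have psi1 : dotp psi psi = 1.
  rewrite linearDl !linearDr /= !linearZl_LR !linearZr_LR /= e00 e01 e10 e11.
  rewrite !rmorphM !rmorph_nat /= cr.
  transitivity ((c * 5) ^+ 2); [ring | by rewrite c5 expr1n].
have coef1L : linear (dotp ^~ e1 : H -> C^o) by move=> a u v; rewrite linearPl.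
pose coef1M := GRing.isLinear.Build _ _ _ _ _ coef1L.
pose coef1 : {linear H -> C^o} := HB.pack (dotp ^~ e1 : H -> C^o) coef1M.
have [h hE] := exists_tensor_functional coef1 coef1 tensorP.
(* [h] is the coordinate along [tensor e1 e1]. The formula needs unit vectors, so it applies to
   [e0], [e1] and [psi] alike. *)
have hD u v : dotp u u = 1 -> dotp v v = 1 -> h (D (tensor u v)) =
    dotp u e1 * (dotp v e1 - 2 * (dotp v u * dotp u e1)).
  move=> u1 v1; rewrite DE ?hE /=; [|exact: unitP..].
  rewrite add_lfunE opp_lfunE scale_lfunE ketbraE id_lfunE.
  by rewrite linearBl !linearZl_LR.
have psie1 : dotp psi e1 = c * 4.
  by rewrite linearDl /= !linearZl_LR /= e01 e11 mulr0 add0r mulr1.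
have e0psi : dotp e0 psi = c * 3.
  rewrite linearDr /= !linearZr_LR /= e00 e01 mulr0 addr0 mulr1.
  by rewrite rmorphM rmorph_nat /= cr.
(* First evaluation: expand [psi] by linearity, then use [hD] at [(e0, e0)] and [(e1, e0)]; both
   values vanish. *)
have : h (D (tensor psi e0)) = 0.
  rewrite linearDl !linearZl_LR linearD !linearZ linearD !linearZ /=.
  by rewrite !hD // e01 !(mul0r, mulr0, subr0, scaler0, addr0).
(* Second evaluation: [hD] at [psi] itself gives a product of nonzero factors, since the
   characteristic is zero. *)
rewrite hD // psie1 e0psi e01 sub0r => /eqP.
by rewrite !(mulf_eq0, oppr_eq0, invr_eq0, pnatr_eq0).
Qed.

Theorem theorem1 (R : realType) (H : vectType R[i])
    (dotp : {dot H for conjC})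
    (HH : vectType R[i]) (tensor : {bilinear H -> H -> HH})
    (tensorP : is_tensor_product tensor)
    (dimH : (2 <= \dim {:H})%N) :
  ~ exists D : 'End(HH),
      forall psi phi : H, unit_vector dotp psi -> unit_vector dotp phi ->
        D (tensor psi phi) =
        tensor psi ((\1 - 2%:R *: ketbra dotp psi psi)%VF phi).
Proof. exact: no_general_diffusion tensorP dimH. Qed.
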